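(* There is an absolute constant $c>0$ such that the following holds. Let $n,k\ge 1$, let $f_1,\dots,f_k\in(\mathbb{C}^n)^*$ be complex linear functionals, and let $f(z)=\sum_{i=1}^k p_i(z)e^{f_i(z)}$, $p_i\in\mathbb{C}[z_1,\dots,z_n]$, be a quasipolynomial with spectrum $f_1,\dots,f_k$ and of degree $m$. Put $M:=\max_{i}\|f_i\|$. Then for every $x\in B_c(0,1)$, every real straight line $l_x\subset\mathbb{C}^n=\mathbb{R}^{2n}$ passing through $x$, every interval $I\subset l_x\cap B_c(0,1)$ and every measurable subset $\omega\subset I$ with $|\omega|>0$, $$\sup_I|f|\le\left(\frac{4|I|}{|\omega|}\right)^{c(\sqrt{k}\,M+m)}\sup_\omega|f|.$$
   Context: $B_c(0,1)\subset\mathbb{C}^n$ is the open complex Euclidean unit ball centered at $0$. A quasipolynomial with spectrum $f_1,\dots,f_k\in(\mathbb{C}^n)^*$ is a finite sum $f(z)=\sum_{i=1}^k p_i(z)e^{f_i(z)}$ with $p_i\in\mathbb{C}[z_1,\dots,z_n]$; its degree is $m=\sum_{i=1}^k(1+\deg p_i)$ (with the convention $\deg 0=0$). $\|f_i\|$ is the Euclidean ($\ell^2$) norm of the linear functional $f_i$, i.e. $\|f_i\|=\sup_{|v|=1}|f_i(v)|$ for the Euclidean norm $|v|$ on $\mathbb{C}^n$. For subsets of a real line, $|\cdot|$ denotes one-dimensional Lebesgue measure. *)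

(* Defs.v *)
From HB Require Import structures.
From mathcomp Require Import all_boot all_order all_algebra.
(* The notations of mpoly clash with those of analysis. *)
From mathcomp Require Import -(notations) mpoly.
From mathcomp Require Import all_classical all_reals all_analysis.
From mathcomp Require Import complex.

Set Implicit Arguments.
Unset Strict Implicit.
Unset Printing Implicit Defensive.

Import Order.TTheory GRing.Theory Num.Theory.
Import numFieldNormedType.Exports.

Local Open Scope classical_set_scope.
Local Open Scope ring_scope.
Local Open Scope complex_scope.

Section Quasipolynomials.
Variable R : realType.

(* The R-valued modulus; `|z| would be an element of R[i]. *)
Definition cmod (z : R[i]) : R := Normc.normc z.

Definition cexp (z : R[i]) : R[i] :=
  (expR (complex.Re z))%:C * (cos (complex.Im z) +i* sin (complex.Im z)).

Section Dimension.
Variable n : nat.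

Definition enorm (z : 'rV[R[i]]_n) : R :=
  Num.sqrt (\sum_(j < n) cmod (z ord0 j) ^+ 2).

Definition unit_ball : set 'rV[R[i]]_n := [set z | enorm z < 1].

(* The set is bounded, and it is nonempty when 0 < n. *)
Definition dual_norm (phi : {scalar 'rV[R[i]]_n}) : R :=
  sup [set cmod (phi v) | v in [set v | enorm v = 1]].

(* mmeasure mdeg p is msize p: 1 + deg p, or 0 if p = 0; hence deg 0 = 0. *)
Definition mpoly_deg (p : mpoly n R[i]) : nat :=
  (mmeasure (@mdeg n) p).-1.

Section Family.
Variable k : nat.
Variables (lam : 'I_k -> {scalar 'rV[R[i]]_n}) (p : 'I_k -> mpoly n R[i]).

Definition quasipoly (z : 'rV[R[i]]_n) : R[i] :=
  \sum_(i < k) meval (fun j => z ord0 j) (p i) * cexp (lam i z).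

Definition quasipoly_deg : nat := (\sum_(i < k) (1 + mpoly_deg (p i)))%N.

(* The norms are nonnegative, so the default value 0 is harmless when 0 < k. *)
Definition spectrum_norm : R := \big[Num.max/0]_(i < k) dual_norm (lam i).

End Family.

(* If enorm v = 1, this is an isometry from R onto a real line of
   C^n = R^(2n) through x, and every such line arises in this way. *)
Definition line_param (x v : 'rV[R[i]]_n) (t : R) : 'rV[R[i]]_n :=
  x + t%:C *: v.

Definition real_line (x v : 'rV[R[i]]_n) : set 'rV[R[i]]_n :=
  range (line_param x v).

Definition line_interval (x v : 'rV[R[i]]_n) (A : set 'rV[R[i]]_n) : Prop :=
  A `<=` real_line x v /\ is_interval (line_param x v @^-1` A).

(* Lebesgue measurability, in the Caratheodory sense. *)
Definition line_measurable (x v : 'rV[R[i]]_n) (A : set 'rV[R[i]]_n) : Prop :=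
  A `<=` real_line x v /\
  ((wlength idfun)^*%mu).-cara.-measurable (line_param x v @^-1` A).

Definition line_measure (x v : 'rV[R[i]]_n) (A : set 'rV[R[i]]_n) : \bar R :=
  completed_lebesgue_measure (line_param x v @^-1` A).

Definition sup_mod (f : 'rV[R[i]]_n -> R[i]) (A : set 'rV[R[i]]_n) : \bar R :=
  ereal_sup [set (cmod (f z))%:E | z in A].

End Dimension.
End Quasipolynomials.

(* Main.v *)
Require Import Defs.
From HB Require Import structures.
From mathcomp Require Import all_boot all_order all_algebra.
From mathcomp Require Import -(notations) mpoly.
From mathcomp Require Import all_classical all_reals all_analysis.
From mathcomp Require Import complex.
From mathcomp Require Import ring lra zify.

(** Restricted to a real line, a quasipolynomial of degree m becomes an
    exponential polynomial g(u) = sum_i q_i(u) exp(mu_i u) of one real variable,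
    with |mu_i| <= M times the length scale and sum_i (1 + deg q_i) <= m.  For
    such a g the argument is algebra on its Taylor coefficients a_l at 0.

    Write l! a_l = Phi(X^l), where Phi is the linear functional on polynomials
    sending Q to sum_i sum_d q_(i,d) Q^(d)(mu_i).  It kills every multiple of
    P = prod_i (X - mu_i)^(1 + deg q_i), so each a_l is determined by
    a_0, ..., a_(m-1) through the remainder of X^l modulo P.  For the remainder
    of X^l modulo a product of factors X - z with |z| <= rho there is a bound on
    the coefficients that does not depend on the number of factors
    (wnorm_modXn), and this gives, for Lambda >= max(|mu_i|, m),
      |a_l| <= (3 Lambda)^l / l! * (|a_0| + ... + |a_(m-1)|)
    (taylor_coef_le).

    Now take N points in the small set, N being a large multiple of Lambda, and
    let W be the monic polynomial vanishing at them.  Up to the tail l >= N, the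
    coefficients a_j, j < N, are those of the interpolation polynomial of g at
    the points; the same bound on remainders, now modulo W, shows that
    the tail contributes at most half of |a_0| + ... + |a_(m-1)|.  Hence this
    jet norm is at most twice the norm of the interpolation polynomial
    (jet_norm_le_interpolant), which Lagrange's formula bounds by the values of
    g at the points (wnorm_lagrange), and exp(3 Lambda) times the jet norm bounds
    g on the whole interval.  Interpolating at nodes of the small set directly, rather than
    approximating g by a polynomial first, is what keeps the ratio of the
    measures from being raised to the power N in front of the error term.

    A set of outer measure w contains N points with consecutive gaps at least
    w / (2 N) (spaced_nodes); with such nodes the Lagrange constants are
    exponential in N, and N is of order M + m.  The exponent obtained is thus a
    multiple of M + m, which sqrt k * M + m dominates. *)

Set Implicit Arguments.
Unset Strict Implicit.
Unset Printing Implicit Defensive.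

Import Order.TTheory GRing.Theory Num.Theory.
Import numFieldNormedType.Exports.

Local Open Scope classical_set_scope.
Local Open Scope ring_scope.

(** * Remainders modulo products of linear factors *)

Section WeightedNorm.
Variable F : numFieldType.
Implicit Types (s z rho : F) (p q : {poly F}) (Z : seq F).

(** The l^1 norm of the coefficients of p(s X). *)
Definition wnorm s p : F := \sum_(i < size p) `|p`_i| * s ^+ i.

Lemma wnormE s n p : (size p <= n)%N ->
  wnorm s p = \sum_(i < n) `|p`_i| * s ^+ i.
Proof.
move=> pn; rewrite /wnorm (big_ord_widen n (fun i => `|p`_i| * s ^+ i)) //.
rewrite big_mkcond; apply: eq_bigr => i _; case: ltnP => // pi.
by rewrite nth_default // normr0 mul0r.
Qed.

Lemma wnorm_ge0 s p : 0 <= s -> 0 <= wnorm s p.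
Proof. by move=> s0; apply: sumr_ge0 => i _; rewrite mulr_ge0 // exprn_ge0. Qed.

Lemma wnormC s (a : F) : wnorm s a%:P = `|a|.
Proof.
by rewrite (wnormE _ (size_polyC_leq1 a)) big_ord1 coefC mulr1.
Qed.

Lemma wnorm0 s : wnorm s 0 = 0.
Proof. by rewrite /wnorm size_poly0 big_ord0. Qed.

Lemma wnormD s p q : 0 <= s -> wnorm s (p + q) <= wnorm s p + wnorm s q.
Proof.
move=> s0; set n := maxn (size p) (size q).
rewrite (@wnormE _ n (p + q)) ?size_polyD // (@wnormE _ n p) ?leq_maxl //.
rewrite (@wnormE _ n q) ?leq_maxr // -big_split /=; apply: ler_sum => i _.
by rewrite -mulrDl ler_wpM2r ?exprn_ge0 // coefD ler_normD.
Qed.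

Lemma wnormZ s (a : F) p : wnorm s (a *: p) = `|a| * wnorm s p.
Proof.
rewrite (wnormE _ (size_scale_leq a p)) /wnorm big_distrr /=.
by apply: eq_bigr => i _; rewrite coefZ normrM mulrA.
Qed.

Lemma wnorm_sum s (I : Type) (r : seq I) (P : pred I) (f : I -> {poly F}) :
  0 <= s -> wnorm s (\sum_(i <- r | P i) f i) <= \sum_(i <- r | P i) wnorm s (f i).
Proof.
move=> s0; elim/big_rec2: _ => [|i y x _ h]; first by rewrite wnorm0.
by apply: le_trans (wnormD _ _ s0) _; rewrite lerD2l.
Qed.

Lemma wnorm_mulX s p : wnorm s ('X * p) = s * wnorm s p.
Proof.
have h : (size (('X : {poly F}) * p)%R <= (size p).+1)%N.
  by apply: leq_trans (size_polyMleq _ _) _; rewrite size_polyX.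
rewrite (wnormE _ h) big_ord_recl coefXM eqxx normr0 mul0r add0r /wnorm.
rewrite big_distrr /=; apply: eq_bigr => i _.
by rewrite coefXM /= /bump leq0n add1n /= exprS mulrCA.
Qed.

Lemma wnorm_mulXsubC s z p : 0 <= s ->
  wnorm s (('X - z%:P) * p) <= (s + `|z|) * wnorm s p.
Proof.
move=> s0; rewrite mulrBl mul_polyC -scaleNr.
by apply: le_trans (wnormD _ _ s0) _; rewrite wnorm_mulX wnormZ normrN mulrDl.
Qed.

Lemma wnorm_prodXsubC s (I : eqType) (r : seq I) (P : pred I) (x : I -> F) rho :
  0 <= s -> 0 <= rho -> (forall i, `|x i| <= rho) ->
  wnorm s (\prod_(i <- r | P i) ('X - (x i)%:P)) <=
  \prod_(i <- r | P i) (s + rho).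
Proof.
move=> s0 r0 hx; elim/big_rec2: _ => [|i y p _ h].
  by rewrite wnormC normr1.
apply: le_trans (wnorm_mulXsubC _ _ s0) _.
by rewrite ler_pM ?addr_ge0 ?wnorm_ge0 // lerD2l.
Qed.

Lemma wnorm_horner s p (u : F) : `|u| <= s -> `|p.[u]| <= wnorm s p.
Proof.
move=> us; rewrite horner_coef; apply: le_trans (ler_norm_sum _ _ _) _.
apply: ler_sum => i _; rewrite normrM normrX ler_wpM2l //.
by rewrite lerXn2r ?nnegrE // (le_trans _ us).
Qed.

(** One step of Newton interpolation at the node z.  The right side has degree
    below the number of nodes, so uniqueness of the remainder applies. *)
Lemma modp_consXsubC z Z p q : p = p.[z]%:P + ('X - z%:P) * q ->
  p %% (\prod_(y <- z :: Z) ('X - y%:P)) =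
  p.[z]%:P + ('X - z%:P) * (q %% (\prod_(y <- Z) ('X - y%:P))).
Proof.
move=> pE; rewrite big_cons; set W := \prod_(y <- Z) _.
have W0 : W != 0 by rewrite monic_neq0 // monic_prod_XsubC.
apply: esym; apply: (@modpP _ _ (q %/ W)).
  by rewrite [LHS]pE {1}(divp_eq q W); ring.
have sW : size (('X - z%:P) * W) = (size W).+1.
  by rewrite size_Mmonic ?monic_prod_XsubC ?polyXsubC_eq0 // size_XsubC.
rewrite sW ltnS; apply: leq_trans (size_polyD _ _) _.
rewrite geq_max (leq_trans (size_polyC_leq1 _)) ?size_poly_gt0 //=.
apply: leq_trans (size_polyMleq _ _) _; rewrite size_XsubC /=.
by rewrite ltn_modp.
Qed.

Lemma modp_sumZ (W : {poly F}) n (c : nat -> F) (f : nat -> {poly F}) :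
  (\sum_(i < n) c i *: f i) %% W = \sum_(i < n) c i *: (f i %% W).
Proof.
elim: n => [|n IH]; first by rewrite !big_ord0 mod0p.
by rewrite !big_ord_recr /= modpD IH modpZl.
Qed.

(** Splitting off the node z leaves the quotient sum_i z^(l-1-i) X^i of X^l, and
    the inductive bounds for the powers X^i add up, as a telescoping geometric
    sum, to the bound for X^l.  That the bound is independent of the number of
    nodes is essential: it serves both for the characteristic polynomial of a
    recurrence and for the many nodes of an interpolation. *)
Lemma wnorm_modXn s rho Z l : 0 <= s -> 0 <= rho ->
  (forall z, z \in Z -> `|z| <= rho) ->
  wnorm s ('X^l %% \prod_(z <- Z) ('X - z%:P)) <= (s + rho *+ 2) ^+ l.
Proof.
move=> s0 r0; elim: Z l => [|z Z IH] l hZ.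
  rewrite big_nil modp1 wnorm0 exprn_ge0 // addr_ge0 // mulrn_wge0 //.
have hz : `|z| <= rho by rewrite hZ ?mem_head.
have {}IH k := IH k (fun y yZ => hZ y (@mem_behead _ (z :: Z) y yZ)).
set W := \prod_(y <- Z) _ in IH.
pose q : {poly F} := \sum_(i < l) z ^+ (l.-1 - i) *: 'X^i.
have qE : 'X^l = ('X^l).[z]%:P + ('X - z%:P) * q.
  apply/eqP; rewrite hornerXn addrC -subr_eq polyC_exp subrXX.
  apply/eqP; rewrite (reindex_inj rev_ord_inj) /=; congr (_ * _).
  apply: eq_bigr => i _.
  have hi := ltn_ord i.
  by rewrite mulrC -polyC_exp mul_polyC; congr (_ ^+ _ *: _ ^+ _); lia.
rewrite (modp_consXsubC Z qE) hornerXn.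
apply: le_trans (wnormD _ _ s0) _; rewrite wnormC.
apply: (@le_trans _ _ (rho ^+ l + (s + rho) *
   \sum_(i < l) rho ^+ (l.-1 - i) * (s + rho *+ 2) ^+ i)).
  apply: lerD; first by rewrite normrX lerXn2r ?nnegrE.
  apply: le_trans (wnorm_mulXsubC _ _ s0) _.
  apply: ler_pM; rewrite ?addr_ge0 ?wnorm_ge0 ?lerD2l //.
  rewrite (modp_sumZ W _ (fun i => z ^+ (l.-1 - i)) (fun i => 'X^i)).
  apply: le_trans (wnorm_sum _ _ _ s0) _; apply: ler_sum => i _.
  rewrite wnormZ ler_pM ?wnorm_ge0 // normrX.
  by rewrite lerXn2r ?nnegrE.
rewrite -lerBrDl; have -> : s + rho = (s + rho *+ 2) - rho by rewrite mulr2n addrA addrK.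
rewrite subrXX (reindex_inj rev_ord_inj) /= le_eqVlt; apply/orP; left.
apply/eqP; congr (_ * _); apply: eq_bigr => i _; have hi := ltn_ord i.
by rewrite mulrC; congr (_ ^+ _ * _ ^+ _); lia.
Qed.
End WeightedNorm.

(** * Taylor coefficients governed by a linear recurrence *)

Lemma fact_le_expn j m : (j <= m)%N -> (j`! <= m ^ j)%N.
Proof.
elim: j => // j IH jm; rewrite factS expnS leq_mul // IH //; exact: ltnW.
Qed.

Section Recurrence.
Variables (F : numFieldType) (Phi : {scalar {poly F}}) (Z : seq F) (L : F).

(** The l-th Taylor coefficient at 0 of the function u |-> Phi (exp (u X)). *)
Definition taylor_coef l : F := Phi 'X^l / l`!%:R.

Definition taylor_poly K : {poly F} := \poly_(l < K) taylor_coef l.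

Definition jet_norm : F := \sum_(j < size Z) `|taylor_coef j|.

Hypothesis annihilated : forall q, Phi (q * \prod_(z <- Z) ('X - z%:P)) = 0.
Hypothesis Z_le : forall z, z \in Z -> `|z| <= L.
Hypothesis size_Z_le : (size Z)%:R <= L.

Let L0 : 0 <= L.
Proof. exact: le_trans (ler0n _ _) size_Z_le. Qed.

Let jet_norm0 : 0 <= jet_norm.
Proof. exact: sumr_ge0. Qed.

(** Phi X^l = Phi r, where r is the remainder of X^l modulo the annihilating
    polynomial.  Weighting the coefficients of r by the powers of L absorbs the
    factorials j!, since j! <= (size Z)^j <= L^j for j < size Z. *)
Lemma taylor_coef_le l :
  `|taylor_coef l| <= (L *+ 3) ^+ l / l`!%:R * jet_norm.
Proof.
have f0 k : 0 < k`!%:R :> F by rewrite ltr0n fact_gt0.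
rewrite /taylor_coef normrM normfV [`|_%:R|]ger0_norm ?(ltW (f0 _)) //.
rewrite mulrAC ler_wpM2r ?invr_ge0 ?(ltW (f0 _)) //.
pose W := \prod_(z <- Z) ('X - z%:P).
have W0 : W != 0 by rewrite monic_neq0 // monic_prod_XsubC.
set r := 'X^l %% W.
have sr : (size r <= size Z)%N by rewrite -ltnS -(size_prod_XsubC Z id) ltn_modp.
have -> : Phi 'X^l = Phi r.
  by rewrite {1}(divp_eq 'X^l W) raddfD /= [X in X + _]annihilated add0r.
have -> : Phi r = \sum_(j < size Z) r`_j * (j`!%:R * taylor_coef j).
  rewrite -[r in LHS]coefK poly_def raddf_sum /=.
  rewrite (big_ord_widen _ (fun i => Phi (r`_i *: 'X^i)) sr) big_mkcond /=.
  apply: eq_bigr => j _; case: ltnP => jr; last by rewrite nth_default ?mul0r.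
  rewrite linearZ /=; congr (_ * _).
  by rewrite /taylor_coef mulrCA mulfV ?mulr1 // gt_eqF.
have h := wnorm_modXn l L0 L0 Z_le.
have {h}h : wnorm L r <= (L *+ 3) ^+ l by apply: le_trans h _; rewrite -mulrS.
apply: le_trans (ler_wpM2r jet_norm0 h).
rewrite (wnormE _ sr) big_distrl /=; apply: le_trans (ler_norm_sum _ _ _) _.
apply: ler_sum => j _; rewrite 2!normrM -!mulrA ler_wpM2l //.
rewrite ler_pM //; last by rewrite /jet_norm (bigD1 j) //= lerDl sumr_ge0.
rewrite ger0_norm ?ler0n //; apply: (@le_trans _ _ ((size Z)%:R ^+ j)).
  by rewrite -natrX ler_nat fact_le_expn // ltnW.
by rewrite lerXn2r ?nnegrE.
Qed.

Lemma taylor_poly_le K u : `|u| <= 1 ->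
  `|(taylor_poly K).[u]| <= (\sum_(l < K) (L *+ 3) ^+ l / l`!%:R) * jet_norm.
Proof.
move=> u1; apply: le_trans (wnorm_horner _ u1) _.
rewrite (wnormE _ (size_poly _ _)) big_distrl /=; apply: ler_sum => l _.
by rewrite coef_poly ltn_ord expr1n mulr1 taylor_coef_le.
Qed.

(** Reduction modulo the nodal polynomial fixes the Taylor coefficients of order
    below the number of nodes, and by wnorm_modXn and taylor_coef_le it changes
    them by at most half of the jet norm through the tail; that half is absorbed
    in the left-hand side. *)
Lemma jet_norm_le_interpolant (ts : seq F) K :
  (forall t, t \in ts -> `|t| <= 1) ->
  (size Z <= size ts)%N -> (size ts <= K)%N ->
  \sum_(size ts <= l < K) (L *+ 9) ^+ l / l`!%:R <= 2^-1 ->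
  jet_norm <= 2 * wnorm 1 (taylor_poly K %% \prod_(t <- ts) ('X - t%:P)).
Proof.
move=> ts1; set N := size ts => ZN NK tail.
set W := \prod_(t <- ts) _; set r := _ %% W.
have lin n (f : nat -> {poly F}) : (\sum_(n <= l < K) f l) %% W =
    \sum_(n <= l < K) (f l %% W).
  exact: (big_morph (fun p => p %% W) (modpD W) (mod0p W)).
have rE : r = \poly_(l < N) taylor_coef l +
    \sum_(N <= l < K) taylor_coef l *: ('X^l %% W).
  rewrite /r /taylor_poly !poly_def.
  rewrite -(big_mkord xpredT (fun l => taylor_coef l *: 'X^l)).
  rewrite (big_cat_nat (leq0n N) NK) /= modpD lin big_mkord -poly_def; congr (_ + _).
    by rewrite modp_small // size_prod_XsubC ltnS size_poly.
  by apply: eq_bigr => l _; rewrite modpZl.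
have jetE : wnorm 1 (\poly_(l < N) taylor_coef l) =
    \sum_(l < N) `|taylor_coef l|.
  rewrite (wnormE _ (size_poly _ _)); apply: eq_bigr => l _.
  by rewrite coef_poly ltn_ord expr1n mulr1.
have jet_le : jet_norm <= \sum_(l < N) `|taylor_coef l|.
  rewrite /jet_norm (big_ord_widen _ (fun l => `|taylor_coef l|) ZN) big_mkcond.
  by apply: ler_sum => l _; case: ifP.
have tail_le : wnorm 1 (\sum_(N <= l < K) taylor_coef l *: ('X^l %% W)) <=
    2^-1 * jet_norm.
  apply: le_trans (wnorm_sum _ _ _ ler01) _.
  apply: le_trans (ler_wpM2r jet_norm0 tail); rewrite big_distrl /=.
  apply: ler_sum => l _; rewrite wnormZ.
  have h := wnorm_modXn l ler01 ler01 ts1.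
  apply: le_trans (ler_pM (normr_ge0 _) (wnorm_ge0 _ ler01)
    (taylor_coef_le l) h) _.
  rewrite -/W le_eqVlt; apply/orP; left; apply/eqP.
  (* 9 = 3 * 3: growth of the Taylor coefficients times that of X^l mod W *)
  rewrite (_ : L *+ 9 = (L *+ 3) * (1 + 1 *+ 2)); last by rewrite -mulrS; ring.
  by rewrite exprMn; ring.
have : jet_norm <= wnorm 1 r + 2^-1 * jet_norm.
  apply: le_trans jet_le _; rewrite -jetE.
  apply: (le_trans _ (lerD (lexx _) tail_le)).
  have {1}-> : \poly_(l < N) taylor_coef l =
      r + (-1) *: \sum_(N <= l < K) taylor_coef l *: ('X^l %% W).
    by rewrite scaleN1r rE addrK.
  by apply: le_trans (wnormD _ _ ler01) _; rewrite wnormZ normrN1 mul1r.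
move=> h; rewrite -(ler_pM2l (x := 2^-1)) ?invr_gt0 ?ltr0n // mulKf ?pnatr_eq0 //.
rewrite -(lerD2r (2^-1 * jet_norm)); apply: le_trans h.
by rewrite -mulrDl -[2^-1]mul1r -splitr mul1r.
Qed.

End Recurrence.

(** * Lagrange interpolation *)

Section Lagrange.
Variables (F : numFieldType) (N : nat) (x : 'I_N -> F).
Hypothesis x_inj : injective x.

Local Notation basis i := (\prod_(j | j != i) ('X - (x j)%:P)).

Lemma lagrange_interpolation (r : {poly F}) : (size r <= N)%N ->
  r = \sum_i (r.[x i] / \prod_(j | j != i) (x i - x j)) *: basis i.
Proof.
move=> sr; apply/eqP; rewrite -subr_eq0; apply/eqP.
apply: (@roots_geq_poly_eq0 _ _ [seq x i | i <- enum 'I_N]).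
- apply/allP => _ /mapP[i _ ->]; rewrite /root hornerD hornerN horner_sum.
  rewrite (bigD1 i) //= [X in _ - (_ + X)]big1 ?addr0 => [|j ji].
    have basisE : (basis i).[x i] = \prod_(j | j != i) (x i - x j).
      by rewrite horner_prod; apply: eq_bigr => j _; rewrite hornerXsubC.
    rewrite hornerZ basisE divfK ?subrr //; apply/prodf_neq0 => j ji.
    by rewrite subr_eq0 (inj_eq x_inj) eq_sym.
  have basis0 : (basis j).[x i] = 0.
    rewrite horner_prod (bigD1 i) /=; last by rewrite eq_sym.
    by rewrite hornerXsubC subrr mul0r.
  by rewrite hornerZ basis0 mulr0.
- by rewrite map_inj_uniq // enum_uniq.
rewrite size_map size_enum_ord; apply: leq_trans (size_polyD _ _) _.
rewrite geq_max sr size_polyN; apply: leq_trans (size_sum _ _ _) _.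
apply/bigmax_leqP => i _; apply: leq_trans (size_scale_leq _ _) _.
rewrite size_prod => [|j _]; last by rewrite polyXsubC_eq0.
rewrite (eq_bigr (fun=> 2%N)) => [|j _]; last by rewrite size_XsubC.
rewrite sum_nat_const cardC1 card_ord.
by case: N i => [[]//|n] _; lia.
Qed.

(** Each factor X - x j of a Lagrange numerator has norm at most 2. *)
Lemma wnorm_lagrange (r : {poly F}) : (size r <= N)%N ->
  (forall i, `|x i| <= 1) ->
  wnorm 1 r <= \sum_i `|r.[x i]| * (2 ^+ N / \prod_(j | j != i) `|x i - x j|).
Proof.
move=> sr x1; rewrite {1}(lagrange_interpolation sr).
apply: le_trans (wnorm_sum _ _ _ ler01) _; apply: ler_sum => i _.
rewrite wnormZ normrM normfV normr_prod -mulrA ler_wpM2l // mulrC.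
rewrite ler_wpM2r ?invr_ge0 ?prodr_ge0 //.
apply: le_trans (wnorm_prodXsubC _ _ ler01 ler01 x1) _.
rewrite prodr_const cardC1 card_ord -[1 + 1]/(2 : F).
by rewrite ler_weXn2l ?ler1n // leq_pred.
Qed.

End Lagrange.

(** * The symbol of an exponential polynomial *)

Definition exp_sum (F : fieldType) n (z : F) : F := \sum_(l < n) z ^+ l / l`!%:R.

Lemma derivn_XsubC_exp_root (F : fieldType) (c : F) d e (q : {poly F}) :
  (d < e)%N -> (q * ('X - c%:P) ^+ e)^`(d).[c] = 0.
Proof.
elim: d e q => [|d IH] [//|e] q de.
  by rewrite derivn0 hornerM exprS hornerM hornerXsubC subrr !(mul0r, mulr0).
rewrite derivSn derivM deriv_exp derivXsubC /=.
rewrite (_ : _ + _ = (q^`() * ('X - c%:P) + q *+ e.+1) * ('X - c%:P) ^+ e) ?IH //.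
by rewrite exprS mul1r mulrA mulrDl mulrnAr mulrnAl.
Qed.

Section ExpSymbol.
Variables (F : numFieldType) (k : nat) (q : 'I_k -> {poly F}) (mu : 'I_k -> F).

(** The functional Phi with Phi (exp (u X)) = sum_i q_i(u) exp(mu_i u): the term
    u^d exp(mu u) corresponds to taking the d-th derivative at mu. *)
Definition exp_symbol (Q : {poly F}) : F :=
  \sum_i \sum_(d < size (q i)) (q i)`_d * Q^`(d).[mu i].

Lemma exp_symbol_is_scalar : scalar exp_symbol.
Proof.
move=> a P Q; rewrite /exp_symbol big_distrr -big_split /=.
apply: eq_bigr => i _; rewrite big_distrr -big_split /=; apply: eq_bigr => d _.
by rewrite derivnD derivnZ hornerD hornerZ mulrDr mulrCA.
Qed.

HB.instance Definition _ :=
  GRing.isLinear.Build F {poly F} F *%R exp_symbol exp_symbol_is_scalar.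

(** The roots, with multiplicity, of the characteristic polynomial. *)
Definition freq_seq := flatten [seq nseq (size (q i)) (mu i) | i <- enum 'I_k].

Lemma size_freq_seq : size freq_seq = (\sum_i size (q i))%N.
Proof.
rewrite size_flatten /shape -map_comp sumnE big_map big_enum /=.
by apply: eq_bigr => i _; rewrite size_nseq.
Qed.

Lemma freq_seqP z : z \in freq_seq -> exists i, z = mu i.
Proof. by case/flattenP => _ /mapP[i _ ->] /nseqP[-> _]; exists i. Qed.

(** The i-th term evaluates derivatives of order below size (q i) at a root of
    multiplicity at least size (q i). *)
Lemma exp_symbol_annihilated Q :
  exp_symbol (Q * \prod_(z <- freq_seq) ('X - z%:P)) = 0.
Proof.
rewrite /exp_symbol big1 // => i _; rewrite big1 // => d _.
rewrite big_flatten big_map big_enum /= (bigD1 i) //= big_nseq iter_mulr_1.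
by rewrite mulrCA [_ ^+ _ * _]mulrC derivn_XsubC_exp_root ?mulr0.
Qed.

(** The d-th derivative of X^l / l! at mu is mu^(l-d) / (l-d)!. *)
Lemma taylor_poly_exp_symbol K (u : F) :
  (taylor_poly exp_symbol K).[u] =
  \sum_i \sum_(d < size (q i)) (q i)`_d * u ^+ d * exp_sum (K - d) (mu i * u).
Proof.
rewrite /taylor_poly horner_poly.
transitivity (\sum_(l < K) \sum_i \sum_(d < size (q i))
    (q i)`_d * ('X^l)^`(d).[mu i] * u ^+ l / l`!%:R).
  apply: eq_bigr => l _; rewrite mulrAC big_distrl /= big_distrl.
  by apply: eq_bigr => i _; rewrite !big_distrl.
rewrite exchange_big /=; apply: eq_bigr => i _.
rewrite exchange_big /=; apply: eq_bigr => d _.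
rewrite -(big_mkord xpredT (fun l => (q i)`_d * ('X^l)^`(d).[mu i] * u ^+ l / l`!%:R)).
have f0 n : n`!%:R != 0 :> F by rewrite pnatr_eq0 -lt0n fact_gt0.
have [Kd|dK] := leqP K d.
  move: (Kd); rewrite -subn_eq0 => /eqP ->.
  rewrite /exp_sum big_ord0 mulr0 big_nat big1 // => l /andP[_ lK].
  by rewrite derivnXn ffact_small ?mulr0n ?horner0 ?mulr0 ?mul0r // (leq_trans lK).
rewrite (big_cat_nat (leq0n d) (ltnW dK)) /= big_nat big1 ?add0r; last first.
  move=> l /andP[_ ld].
  by rewrite derivnXn ffact_small ?mulr0n ?horner0 ?mulr0 ?mul0r.
rewrite -{1}[d : nat]add0n big_addn big_mkord /exp_sum big_distrr /=.
apply: eq_bigr => j _; rewrite derivnXn hornerMn hornerXn addnK exprMn.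
have := ffact_fact (leq_addl j d); rewrite addnK => h.
rewrite exprD -mulr_natr -h natrM; field.
by rewrite f0 pnatr_eq0 -lt0n ffact_gt0 leq_addl.
Qed.

End ExpSymbol.

(** * The complex exponential as a power series *)

Section ExpSum.
Variable F : numFieldType.
Implicit Types a b : F.

(** By the binomial formula, exp_sum K (a + b) collects the terms of the product
    that lie in the triangle i + j < K. *)
Lemma exp_sumD K a b : exp_sum K a * exp_sum K b - exp_sum K (a + b) =
  \sum_(i < K) \sum_(K - i <= j < K) a ^+ j / j`!%:R * (b ^+ i / i`!%:R).
Proof.
pose f j i : F := a ^+ j / j`!%:R * (b ^+ i / i`!%:R).
have f0 n : n`!%:R != 0 :> F by rewrite pnatr_eq0 -lt0n fact_gt0.
have -> : exp_sum K (a + b) = \sum_(i < K) \sum_(0 <= j < K - i) f j i.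
  transitivity (\sum_(l < K) \sum_(i < K | (i <= l)%N) f (l - i)%N i).
    apply: eq_bigr => l _; rewrite exprDn big_distrl /=.
    rewrite (big_ord_widen _ (fun i => a ^+ (l - i) * b ^+ i *+ 'C(l, i) / l`!%:R) (ltn_ord l)).
    apply: eq_bigr => i; rewrite ltnS => il; rewrite /f.
    have h := bin_fact il; rewrite -[in l`!%:R]h !natrM -mulr_natr.
    field; rewrite !f0 /= pnatr_eq0 -lt0n bin_gt0 //.
  rewrite (exchange_big_dep xpredT) //=; apply: eq_bigr => i _.
  rewrite -(big_mkord (fun l => (i <= l)%N) (fun l => f (l - i)%N i)).
  rewrite (big_cat_nat (leq0n i) (ltnW (ltn_ord i))) /= big_nat_cond big1 ?add0r.
    rewrite -{1}[i : nat]add0n big_addn big_mkcond; apply: eq_bigr => j _.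
    by rewrite leq_addl addnK.
  by move=> l /andP[/andP[_ li]]; rewrite leqNgt li.
rewrite mulrC /exp_sum big_distrl /= -sumrB; apply: eq_bigr => i _.
rewrite big_distrr /= -(big_mkord xpredT (fun j => b ^+ i / i`!%:R * (a ^+ j / j`!%:R))).
rewrite (big_cat_nat (leq0n (K - i)) (leq_subr _ _)) /=.
under eq_bigr do rewrite mulrC.
rewrite addrAC subrr add0r; by apply: eq_bigr => j _; rewrite mulrC.
Qed.

(** The defect of additivity at complex arguments is dominated by the one at
    their moduli, which tends to 0 because the real exponential is additive. *)
Lemma exp_sumD_le K a b : `|exp_sum K a * exp_sum K b - exp_sum K (a + b)| <=
  exp_sum K `|a| * exp_sum K `|b| - exp_sum K (`|a| + `|b|).
Proof.
rewrite !exp_sumD; apply: le_trans (ler_norm_sum _ _ _) _; apply: ler_sum => i _.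
apply: le_trans (ler_norm_sum _ _ _) _; apply: ler_sum => j _.
by rewrite !normrM !normfV !normrX !(ger0_norm (ler0n _ _)).
Qed.
End ExpSum.

Section ComplexExponential.
Local Open Scope complex_scope.
Variable R : realType.
Implicit Types (x y : R) (z w : R[i]).

Lemma normrC_cmod z : `|z| = (cmod z)%:C.
Proof. by case: z. Qed.

Lemma cmod_ge0 z : 0 <= cmod z.
Proof. by rewrite /cmod; case: z => a b /=; exact: sqrtr_ge0. Qed.

Lemma exp_sum_realC K x : exp_sum K x%:C = (series (exp_coeff x) K)%:C.
Proof.
rewrite /exp_sum /series /= raddf_sum big_mkord; apply: eq_bigr => l _.
by rewrite /exp_coeff /= fmorph_div rmorphXn rmorph_nat.
Qed.

Lemma exp_sum_imaginary K y :
  exp_sum K (0 +i* y) = series (cos_coeff y) K +i* series (sin_coeff y) K.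
Proof.
have iX l : (0 +i* y) ^+ l =
    ((~~ odd l)%:R * (-1) ^+ l./2 * y ^+ l) +i* ((odd l)%:R * (-1) ^+ l.-1./2 * y ^+ l).
  elim: l => [|l IH]; first by apply/eqP; rewrite eq_complex /= !expr0 !(mul0r, mul1r, mulr1) !eqxx.
  rewrite exprS IH; apply/eqP; rewrite eq_complex /= exprS.
  rewrite uphalfE negbK; apply/andP; split; apply/eqP.
    case: l {IH} => [|l] /=; first by rewrite !mul0r ?mulr0 subrr.
    by case: (odd l) => /=; rewrite ?exprS; ring.
  by case: (odd l) => /=; ring.
rewrite /exp_sum /series /= !big_mkord.
elim: K => [|K IH]; first by rewrite !big_ord0.
rewrite !big_ord_recr /= IH iX.
have -> : (K`!%:R : R[i])^-1 = (K`!%:R^-1)%:C by rewrite fmorphV rmorph_nat.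
by apply/eqP; rewrite eq_complex /= !mulr0 subr0 add0r; apply/andP; split; apply/eqP;
  rewrite /cos_coeff /sin_coeff /=.
Qed.

Lemma exp_sum_cvg x : exp_sum K x @[K --> \oo] --> expR x.
Proof.
have -> : (fun K => exp_sum K x) = series (exp_coeff x).
  by apply/funext => K; rewrite /exp_sum /series /= big_mkord.
exact: is_cvg_series_exp_coeff.
Qed.

Lemma cmodD z w : cmod (z + w) <= cmod z + cmod w.
Proof. by rewrite -lecR rmorphD /= -!normrC_cmod ler_normD. Qed.

Lemma cmodM z w : cmod (z * w) = cmod z * cmod w.
Proof. exact: Normc.normcM. Qed.

Lemma cmodR x : cmod x%:C = `|x|.
Proof. by rewrite /cmod /= expr0n /= addr0 sqrtr_sqr. Qed.

Lemma cmod_le_Re_Im x y : cmod (x +i* y) <= `|x| + `|y|.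
Proof.
have -> : x +i* y = x%:C + (0 +i* 1) * y%:C.
  by apply/eqP; rewrite eq_complex /= !(mul0r, mul1r, mulr0, subr0, addr0, add0r) !eqxx.
apply: le_trans (cmodD _ _) _; rewrite cmodM !cmodR.
by rewrite /cmod /= expr0n expr1n add0r sqrtr1 mul1r.
Qed.

Lemma cmod_sum_le (I : finType) (f : I -> R[i]) :
  cmod (\sum_i f i) <= \sum_i cmod (f i).
Proof.
rewrite -lecR raddf_sum /= -normrC_cmod; apply: le_trans (ler_norm_sum _ _ _) _.
by apply: ler_sum => i _; rewrite normrC_cmod.
Qed.

(** For z = x + i y the partial sums at z differ by o(1) from the product of the
    partial sums at x and at i y, whose limits are exp x and cos y + i sin y. *)
Lemma exp_sum_cvg_cexp z : cmod (exp_sum K z - cexp z) @[K --> \oo] --> (0 : R).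
Proof.
case: z => x y.
pose A K := series (exp_coeff x) K.
pose C K := series (cos_coeff y) K.
pose S K := series (sin_coeff y) K.
pose D K := exp_sum K `|x| * exp_sum K `|y| - exp_sum K (`|x| + `|y|).
have cA : A K @[K --> \oo] --> expR x by exact: is_cvg_series_exp_coeff.
have cC : C K @[K --> \oo] --> cos y by rewrite unlock; exact: is_cvg_series_cos_coeff.
have cS : S K @[K --> \oo] --> sin y by rewrite unlock; exact: is_cvg_series_sin_coeff.
have cD : D K @[K --> \oo] --> (0 : R).
  rewrite -(subrr (expR (`|x| + `|y|))) {1}expRD.
  by apply: cvgB; [apply: cvgM; exact: exp_sum_cvg | exact: exp_sum_cvg].
apply: (@squeeze_cvgr _ _ _ _ (fun=> 0) (fun K => D K +
  (`|A K * C K - expR x * cos y| + `|A K * S K - expR x * sin y|))).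
- apply: nearW => K; rewrite cmod_ge0 /=.
  have -> : exp_sum K (x +i* y) - cexp (x +i* y) =
      (exp_sum K (x%:C + (0 +i* y)) - exp_sum K x%:C * exp_sum K (0 +i* y)) +
      (A K * C K - expR x * cos y) +i* (A K * S K - expR x * sin y).
    have -> : x +i* y = x%:C + (0 +i* y).
      by apply/eqP; rewrite eq_complex /= addr0 add0r !eqxx.
    rewrite exp_sum_imaginary exp_sum_realC -/(A K) -/(C K) -/(S K) -addrA; congr (_ + _).
    by apply/eqP; rewrite eq_complex /= !(mul0r, addr0, add0r, subr0);
       apply/andP; split; apply/eqP; ring.
  apply: le_trans (cmodD _ _) _; apply: lerD; last exact: cmod_le_Re_Im.
  rewrite -lecR -normrC_cmod distrC; apply: le_trans (exp_sumD_le _ _ _) _.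
  rewrite !normrC_cmod cmodR.
  have -> : cmod (0 +i* y) = `|y| by rewrite /cmod /= expr0n add0r sqrtr_sqr.
  have eR (r : R) : exp_sum K r%:C = (exp_sum K r)%:C.
    by rewrite exp_sum_realC /exp_sum /series /= big_mkord.
  by rewrite -rmorphD /= !eR -rmorphM -rmorphB.
- exact: cvg_cst.
rewrite -[X in _ --> X](addr0 (0 : R)) -[X in _ --> _ + X](addr0 (0 : R)).
apply: cvgD => //; apply: cvgD.
  rewrite -(normr0 R) -(subrr (expR x * cos y)).
  by apply: cvg_norm; apply: cvgB; [exact: cvgM|exact: cvg_cst].
rewrite -(normr0 R) -(subrr (expR x * sin y)).
by apply: cvg_norm; apply: cvgB; [exact: cvgM|exact: cvg_cst].
Qed.

End ComplexExponential.

(** * Numerical estimates *)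

Section ExpBounds.
Variable R : realType.
Implicit Types (x : R).

Lemma exp_sum_le_expR K x : 0 <= x -> exp_sum K x <= expR x.
Proof.
move=> x0.
have -> : exp_sum K x = series (exp_coeff x) K by rewrite /exp_sum /series /= big_mkord.
apply: nondecreasing_cvgn_le; last exact: is_cvg_series_exp_coeff.
by apply/nondecreasing_seqP => n; rewrite seriesSr lerDl exp_coeff_ge0.
Qed.

Lemma expR_half_le n : expR (n%:R / 2) <= 2 ^+ n :> R.
Proof.
rewrite expRM_natl lerXn2r ?nnegrE ?expR_ge0 //.
have := @expR_ge1Dx R (- 2^-1); rewrite expRN => h.
rewrite -[leLHS]invrK -[leRHS]invrK lef_pV2 ?posrE ?invr_gt0 ?expR_gt0 //.
by apply: le_trans h; lra.
Qed.

(** (9 x)^l / l! = 2^-l (18 x)^l / l!, so the tail is at most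
    2^-(n+1) exp(18 x), while exp(18 x) <= 2^n when 36 x <= n. *)
Lemma exp_tail_le n K x : 0 <= x -> x *+ 36 <= n%:R ->
  \sum_(n.+1 <= l < K) (x *+ 9) ^+ l / l`!%:R <= 2^-1.
Proof.
move=> x0 xn.
have y0 : 0 <= x *+ 18 by rewrite mulrn_wge0.
apply: (@le_trans _ _ (2^-1 ^+ n.+1 * expR (x *+ 18))).
  have [nK|Kn] := leqP n.+1 K; last first.
    by rewrite big_geq ?(ltnW Kn) // mulr_ge0 ?exprn_ge0 ?expR_ge0.
  apply: le_trans (ler_wpM2l _ (exp_sum_le_expR K y0)); last exact: exprn_ge0.
  rewrite /exp_sum -(big_mkord xpredT (fun l => (x *+ 18) ^+ l / l`!%:R)).
  rewrite (big_cat_nat (leq0n _) nK) /= mulrDr -[leLHS]add0r lerD //.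
    rewrite mulr_ge0 ?exprn_ge0 ?sumr_ge0 // => i _.
    by rewrite divr_ge0 ?exprn_ge0.
  rewrite big_distrr /=; apply: ler_sum_nat => l /andP[nl _].
  have -> : x *+ 9 = 2^-1 * (x *+ 18) by rewrite -(mulr_natr x 9) -(mulr_natr x 18); lra.
  rewrite exprMn -mulrA ler_wpM2r ?divr_ge0 ?exprn_ge0 //.
  by rewrite ler_wiXn2l //; lra.
rewrite exprS -mulrA ler_piMr // exprVn mulrC ler_pdivrMr ?exprn_gt0 // mul1r.
apply: le_trans (expR_half_le n); rewrite ler_expR.
by move: xn; rewrite -(mulr_natr x 36) -(mulr_natr x 18); lra.
Qed.

(** The subtractions are truncated, so (i - j) + (j - i) is the distance of i
    and j. *)
Lemma prod_distn n i : (i <= n)%N ->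
  (\prod_(j < n.+1 | j != i :> nat) ((i - j) + (j - i)) = i`! * (n - i)`!)%N.
Proof.
move=> i_n; rewrite -(big_mkord (fun j => j != i) (fun j => (i - j) + (j - i))%N).
rewrite (big_cat_nat (n := i)) //=; last exact: ltnW.
rewrite [X in (_ * X)%N]big_ltn_cond // eqxx /=; congr (_ * _)%N.
  rewrite fact_prod big_add1 /= big_nat_rev /= big_nat_cond [RHS]big_nat_cond.
  by apply: eq_big => j; [lia|lia].
rewrite -{1}[i.+1]add0n big_addn subSS [RHS]fact_prod [RHS]big_add1 /=.
rewrite big_nat_cond [RHS]big_nat_cond.
by apply: eq_big => j; [lia|lia].
Qed.

Lemma sum_invf_fact n : \sum_(i < n.+1) (i`! * (n - i)`!)%:R^-1 = 2 ^+ n / n`!%:R :> R.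
Proof.
have f0 m : m`!%:R != 0 :> R by rewrite pnatr_eq0 -lt0n fact_gt0.
rewrite -[2 in RHS]/(1 + 1) exprDn big_distrl; apply: eq_bigr => i _ /=.
have h := @bin_fact n i (leq_ord i).
rewrite !expr1n mul1r -h [in RHS]natrM [in RHS]invfM mulrA mulfV ?mul1r //.
by rewrite pnatr_eq0 -lt0n bin_gt0 -ltnS.
Qed.

(** The i-th product is at least delta^n i! (n - i)!, and the inverses of
    i! (n - i)! add up to 2^n / n!. *)
Lemma sum_inv_prod_nodes n (t : 'I_n.+1 -> R) delta : 0 < delta ->
  (forall i j : 'I_n.+1, (i < j)%N -> delta * (j - i)%:R <= t j - t i) ->
  \sum_i (\prod_(j | j != i) `|t i - t j|)^-1 <= 2 ^+ n / (delta ^+ n * n`!%:R).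
Proof.
move=> d0 gap; rewrite invfM mulrCA -sum_invf_fact big_distrr /=.
apply: ler_sum => i _; rewrite -invfM.
have in_ : (i <= n)%N by rewrite -ltnS.
have dE : delta ^+ n * (i`! * (n - i)`!)%:R =
    \prod_(j < n.+1 | j != i) (delta * ((i - j) + (j - i))%:R).
  rewrite big_split /= prodr_const cardC1 card_ord -prod_distn // natr_prod.
  by congr (_ * _).
rewrite lef_pV2 ?posrE.
- rewrite dE; apply: ler_prod => j ji; rewrite mulr_ge0 ?(ltW d0) //=.
  have [ij|ij|/val_inj ij] := ltngtP i j; last by rewrite ij eqxx in ji.
    have h := gap _ _ ij; rewrite (eqP (ltnW ij)) add0n distrC.
    by apply: le_trans h _; rewrite ler_norm.
  have h := gap _ _ ij; rewrite [X in (_ + X)%N](eqP (ltnW ij)) addn0.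
  by apply: le_trans h _; rewrite ler_norm.
- apply: prodr_gt0 => j ji; rewrite normr_gt0 subr_eq0.
  have [ij|ij|/val_inj ij] := ltngtP i j; last by rewrite ij eqxx in ji.
    by rewrite lt_eqF // -subr_gt0; apply: lt_le_trans (gap _ _ ij); rewrite mulr_gt0 // ltr0n subn_gt0.
  by rewrite gt_eqF // -subr_gt0; apply: lt_le_trans (gap _ _ ij); rewrite mulr_gt0 // ltr0n subn_gt0.
- by rewrite mulr_gt0 ?exprn_gt0 // ltr0n muln_gt0 !fact_gt0.
Qed.

End ExpBounds.

(** * A discrete Remez inequality for exponential polynomials *)

Lemma cvg_bigsum (R : realType) (I : Type) (r : seq I) (f : I -> nat -> R) (l : I -> R) :
  (forall i, f i K @[K --> \oo] --> l i) ->
  (\sum_(i <- r) f i K) @[K --> \oo] --> \sum_(i <- r) l i.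
Proof.
move=> fl; elim: r => [|i r IH].
  have -> : (fun K => \sum_(i <- [::]) f i K) = fun=> 0.
    by apply/funext => K; rewrite big_nil.
  by rewrite big_nil; exact: cvg_cst.
have -> : (fun K => \sum_(i <- i :: r) f i K) = fun K => f i K + \sum_(i <- r) f i K.
  by apply/funext => K; rewrite big_cons.
by rewrite big_cons; apply: cvgD.
Qed.

Section ExpPolynomial.
Local Open Scope complex_scope.
Variables (R : realType) (k : nat).
Variables (q : 'I_k -> {poly R[i]}) (mu : 'I_k -> R[i]).

Definition exp_poly (u : R) : R[i] :=
  \sum_i (q i).[u%:C] * cexp (mu i * u%:C).

Local Notation T := (taylor_poly (exp_symbol q mu)).

Lemma taylor_poly_cvg u : cmod ((T K).[u%:C] - exp_poly u) @[K --> \oo] --> (0 : R).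
Proof.
pose e i d K := cmod ((q i)`_d * u%:C ^+ d) *
  cmod (exp_sum (K - d) (mu i * u%:C) - cexp (mu i * u%:C)).
apply: (@squeeze_cvgr _ _ _ _ (fun=> 0)
  (fun K => \sum_i \sum_(d < size (q i)) e i d K)).
- apply: nearW => K; rewrite cmod_ge0 /= taylor_poly_exp_symbol /exp_poly.
  rewrite -sumrB; apply: le_trans (cmod_sum_le _) _; apply: ler_sum => i _.
  rewrite horner_coef big_distrl -sumrB /=; apply: le_trans (cmod_sum_le _) _.
  by apply: ler_sum => d _; rewrite -mulrBr cmodM.
- exact: cvg_cst.
rewrite [X in _ --> X](_ : 0 = \sum_(i < k) \sum_(d < size (q i)) (0 : R)); last first.
  by rewrite big1 // => i _; rewrite big1.
apply: cvg_bigsum => i; apply: cvg_bigsum => d.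
rewrite -(mulr0 (cmod ((q i)`_d * u%:C ^+ d))); apply: cvgM; first exact: cvg_cst.
rewrite (cvg_centern d (fun K => cmod (exp_sum K (mu i * u%:C) - cexp (mu i * u%:C)))).
exact: exp_sum_cvg_cexp.
Qed.

(** The Remez inequality for the Taylor polynomials of the exponential
    polynomial, with a constant that does not depend on their order K.  The
    condition 36 L <= n makes the tail beyond the nodes harmless (exp_tail_le). *)
Lemma taylor_poly_remez (L : R) n (t : 'I_n.+1 -> R) K (u : R) :
  (forall i, cmod (mu i) <= L) -> (\sum_i size (q i))%:R <= L -> L *+ 36 <= n%:R ->
  injective t -> (forall i, `|t i| <= 1) -> (n < K)%N -> `|u| <= 1 ->
  cmod (T K).[u%:C] <= expR (L *+ 3) * 2 *
    \sum_i cmod (T K).[(t i)%:C] * (2 ^+ n.+1 / \prod_(j | j != i) `|t i - t j|).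
Proof.
move=> muL sizeL Ln t_inj t1 nK u1.
have L0 : 0 <= L by apply: le_trans sizeL; exact: ler0n.
pose Z := freq_seq q mu; pose x i := (t i)%:C.
have ZL z : z \in Z -> `|z| <= L%:C.
  by move=> /freq_seqP[i ->]; rewrite normrC_cmod lecR.
have sZL : (size Z)%:R <= L%:C :> R[i].
  by rewrite size_freq_seq -(rmorph_nat (real_complex R)) lecR.
have ann := exp_symbol_annihilated q mu.
have normC (r : R) : `|r%:C| = `|r|%:C by rewrite normrC_cmod cmodR.
have x1 i : `|x i| <= 1 by rewrite normC -(rmorph1 (real_complex R)) lecR.
have x_inj : injective x by move=> i j /complexI /t_inj.
have u1C : `|u%:C| <= 1 by rewrite normC -(rmorph1 (real_complex R)) lecR.
pose ts := [seq x i | i <- enum 'I_n.+1].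
have sts : size ts = n.+1 by rewrite size_map size_enum_ord.
have ts1 y : y \in ts -> `|y| <= 1 by move=> /mapP[i _ ->].
have LnR : L <= n%:R.
  apply: le_trans Ln; rewrite mulrS lerDl mulrn_wge0 //.
have Zts : (size Z <= size ts)%N.
  rewrite sts size_freq_seq -(ler_nat R); apply: (le_trans sizeL).
  by apply: (le_trans LnR); rewrite ler_nat.
have tail : \sum_(size ts <= l < K) (L%:C *+ 9) ^+ l / l`!%:R <= 2^-1.
  have := exp_tail_le K L0 Ln; rewrite -lecR sts rmorph_sum fmorphV rmorph_nat.
  congr (_ <= _); apply: eq_bigr => l _.
  by rewrite fmorph_div rmorphXn rmorphMn rmorph_nat.
have tsK : (size ts <= K)%N by rewrite sts.
have jet_le := jet_norm_le_interpolant ann ZL sZL ts1 Zts tsK tail.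
have := taylor_poly_le ann ZL sZL K u1C.
set W := \prod_(y <- ts) _ in jet_le => uT.
have sr : (size (T K %% W)%R <= n.+1)%N.
  rewrite -ltnS -sts -(size_prod_XsubC ts id) ltn_modp.
  by rewrite monic_neq0 // monic_prod_XsubC.
have lag := wnorm_lagrange x_inj sr x1.
have WE i : (T K %% W).[x i] = (T K).[x i].
  rewrite {2}(divp_eq (T K) W) hornerD hornerM.
  suff -> : W.[x i] = 0 by rewrite mulr0 add0r.
  by apply/rootP; rewrite root_prod_XsubC map_f // mem_enum.
rewrite -lecR -normrC_cmod; apply: (le_trans uT).
rewrite rmorphM rmorphM /= -mulrA; apply: ler_pM.
- by apply: sumr_ge0 => l _; rewrite divr_ge0 ?exprn_ge0 ?mulrn_wge0 // lecR.
- by apply: sumr_ge0.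
- have := exp_sum_le_expR K (mulrn_wge0 3 L0); rewrite -lecR rmorph_sum.
  congr (_ <= _); apply: eq_bigr => l _.
  by rewrite fmorph_div rmorphXn rmorphMn rmorph_nat.
apply: (le_trans jet_le); rewrite rmorph_nat ler_wpM2l //.
apply: (le_trans lag); rewrite rmorph_sum /=; apply: ler_sum => i _.
rewrite WE normrC_cmod rmorphM /= fmorph_div rmorphXn rmorph_nat rmorph_prod /=.
rewrite le_eqVlt; apply/orP; left; apply/eqP; congr (_ * (_ / _)).
by apply: eq_bigr => j _; rewrite -rmorphB normC.
Qed.

(** The inequality for the Taylor polynomials passes to the limit K --> oo: the
    nodes are finitely many, so pointwise convergence is enough. *)
Lemma exp_poly_remez (L : R) n (t : 'I_n.+1 -> R) (delta S : R) u :
  (forall i, cmod (mu i) <= L) -> (\sum_i size (q i))%:R <= L -> L *+ 36 <= n%:R ->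
  0 < delta ->
  (forall i j : 'I_n.+1, (i < j)%N -> delta * (j - i)%:R <= t j - t i) ->
  (forall i, `|t i| <= 1) -> `|u| <= 1 ->
  (forall i, cmod (exp_poly (t i)) <= S) ->
  cmod (exp_poly u) <= expR (L *+ 3) * 2 * (S * (2 ^+ n.+1 * (2 ^+ n / (delta ^+ n * n`!%:R)))).
Proof.
move=> muL sizeL Ln d0 gap t1 u1 tS.
have t_lt (i j : 'I_n.+1) : (i < j)%N -> t i < t j.
  move=> ij; rewrite -subr_gt0; apply: lt_le_trans (gap _ _ ij).
  by rewrite mulr_gt0 // ltr0n subn_gt0.
have t_inj : injective t.
  move=> i j tij; apply: val_inj; case: (ltngtP i j) => // /t_lt.
    by rewrite tij ltxx.
  by rewrite tij ltxx.
have S0 : 0 <= S by apply: le_trans (tS ord0); exact: cmod_ge0.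
pose c i := 2 ^+ n.+1 / \prod_(j | j != i) `|t i - t j|.
have c0 i : 0 <= c i by rewrite divr_ge0 ?exprn_ge0 ?prodr_ge0.
pose E (v : R) K := cmod ((T K).[v%:C] - exp_poly v).
pose B := expR (L *+ 3) * 2.
have B0 : 0 <= B by rewrite mulr_ge0 ?expR_ge0.
have cE : (E u K + B * \sum_i (S + E (t i) K) * c i) @[K --> \oo] -->
          (0 + B * \sum_i (S + 0) * c i).
  apply: cvgD; first exact: taylor_poly_cvg.
  apply: cvgM; first exact: cvg_cst.
  apply: cvg_bigsum => i; apply: cvgM; last exact: cvg_cst.
  by apply: cvgD; [exact: cvg_cst | exact: taylor_poly_cvg].
apply: (@le_trans _ _ (0 + B * \sum_i (S + 0) * c i)).
  rewrite -(cvg_lim _ cE) //; apply: limr_ge; first exact: cvgP cE.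
  exists n.+1 => // K /= nK.
  have -> : exp_poly u = - ((T K).[u%:C] - exp_poly u) + (T K).[u%:C] by ring.
  apply: le_trans (cmodD _ _) _; rewrite lerD //.
    by rewrite -lecR -normrC_cmod normrN normrC_cmod.
  apply: le_trans (taylor_poly_remez muL sizeL Ln t_inj t1 nK u1) _.
  rewrite -/B ler_wpM2l //; apply: ler_sum => i _; rewrite ler_wpM2r -?/(c i) ?c0 //.
  have -> : (T K).[(t i)%:C] = exp_poly (t i) + ((T K).[(t i)%:C] - exp_poly (t i)) by ring.
  by apply: le_trans (cmodD _ _) _; rewrite lerD.
rewrite add0r ler_wpM2l // addr0 -big_distrr /= ler_wpM2l // -big_distrr /=.
by rewrite ler_wpM2l ?exprn_ge0 //; exact: sum_inv_prod_nodes.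
Qed.

End ExpPolynomial.

(** * Well-spaced points in a set of positive measure *)

Section OuterLebesgue.
Variable R : realType.
Local Notation nu := (@completed_lebesgue_measure R).

Lemma completed_measure_le (A B : set R) : A `<=` B -> (nu A <= nu B)%E.
Proof. exact: (le_outer_measure ((wlength idfun)^*)%mu). Qed.

Lemma completed_measureU2 (A B : set R) : (nu (A `|` B) <= nu A + nu B)%E.
Proof. exact: (outer_measureU2 ((wlength idfun)^*)%mu). Qed.

Lemma completed_measure_ge0 (A : set R) : (0 <= nu A)%E.
Proof. exact: (outer_measure_ge0 ((wlength idfun)^*)%mu). Qed.

Lemma completed_measure_itvcc (a b : R) : a <= b -> nu `[a, b]%classic = (b - a)%:E.
Proof.
move=> ab; have := @lebesgue_measure_itv R `[a, b].
rewrite /= lte_fin => h; transitivity ((if a < b then (b%:E - a%:E)%E else 0%E)); first exact: h.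
by case: ltgtP ab => // -> _; rewrite subrr.
Qed.

(** Pick a point t0 of A within d of its infimum: the part of A to the left of
    t0 + d lies in an interval of length 2 d, and the rest of A provides the
    remaining points. *)
Lemma spaced_nodes n (A : set R) (d : R) : 0 < d -> has_lbound A ->
  (((2 * d) * n%:R)%R%:E <= nu A)%E ->
  exists t : nat -> R, (forall i, (i < n)%N -> A (t i)) /\
    (forall i j, (i < j < n)%N -> d * (j - i)%:R <= t j - t i).
Proof.
move=> d0; elim: n A => [|n IH] A lbA nA.
  by exists (fun=> 0); split => // i j /andP[].
have A0 : A !=set0.
  apply/set0P/negP => /eqP A0; move: nA; rewrite A0.
  have -> : nu set0 = 0%E by exact: (outer_measure0 ((wlength idfun)^*)%mu).
  by rewrite lee_fin leNgt !mulr_gt0.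
pose s := inf A.
have [t0 At0 t0s] : exists2 x, A x & x < s + d by apply: inf_adherent.
pose A' := A `&` [set x | t0 + d <= x].
have /IH : has_lbound A' by case: lbA => l hl; exists l => x [/hl].
have A'n : (((2 * d) * n%:R)%R%:E <= nu A')%E.
  have AE : A `<=` `[s, s + 2 * d]%classic `|` A'.
    move=> x Ax; have [h|h] := leP (t0 + d) x; first by right.
    left; rewrite /= in_itv /=; apply/andP; split; first exact: ge_inf.
    by move: h t0s; lra.
  have := le_trans nA (le_trans (completed_measure_le AE) (completed_measureU2 _ _)).
  have d2 : 0 < 2 * d by rewrite mulr_gt0.
  rewrite completed_measure_itvcc; last by rewrite lerDl ltW.
  have -> : 2 * d * n.+1%:R = 2 * d * n%:R + 2 * d by rewrite -(natr1 n); ring.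
  have -> : s + 2 * d - s = 2 * d by ring.
  by case: (nu A') => [r| |]; rewrite ?leey // -EFinD !lee_fin addrC lerD2l.
move=> /(_ A'n)[t [tA tgap]].
exists (fun i => if i is i'.+1 then t i' else t0); split.
  by case=> [|i] // /tA[].
case=> [|i] [|j] //=; last by move=> h; rewrite subSS; exact: tgap.
rewrite subn0 ltnS => jn.
have [_ /= t00] : A' (t 0%N) by apply: tA; exact: leq_ltn_trans (leq0n j) jn.
case: j jn => [|j] jn; first by move: t00; rewrite mulr1; lra.
have := tgap 0%N j.+1 jn; have -> : d * j.+2%:R = d * j.+1%:R + d by rewrite -(natr1 j.+1); ring.
by rewrite subn0; move: t00; lra.
Qed.

Lemma interval_dist_le (A : set R) a b : is_interval A -> (nu A < +oo)%E ->
  A a -> A b -> `|b - a| <= fine (nu A).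
Proof.
move=> iA fA; wlog ab : a b / a <= b.
  move=> H Aa Ab; have [ab|/ltW ba] := leP a b; first exact: H.
  by rewrite distrC; exact: H.
move=> Aa Ab; rewrite ger0_norm ?subr_ge0 // -lee_fin fineK; last first.
  by rewrite ge0_fin_numE // completed_measure_ge0.
rewrite -completed_measure_itvcc //; apply: completed_measure_le => x /=.
by rewrite in_itv /= => /andP[ax xb]; apply: (iA a b) => //; apply/andP.
Qed.

End OuterLebesgue.

(** * Restriction to a real line *)

Section LineRestriction.
Variables (F : fieldType) (n : nat).
Implicit Types (p : mpoly n F) (y e : 'rV[F]_n).

Definition line_poly p y e : {poly F} :=
  mmap (@polyC F) (fun j => (y ord0 j)%:P + e ord0 j *: 'X) p.

Lemma line_polyE p y e u :
  (line_poly p y e).[u] = meval (fun j => (y + u *: e) ord0 j) p.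
Proof.
rewrite /line_poly /meval /mmap horner_sum; apply: eq_bigr => m _.
rewrite hornerM hornerC /mmap1 horner_prod; congr (_ * _).
apply: eq_bigr => j _; rewrite horner_exp hornerD hornerC hornerZ hornerX.
by rewrite !mxE mulrC.
Qed.

Lemma size_prod_degrees (I : Type) (r : seq I) (f : I -> {poly F}) (d : I -> nat) :
  (forall i, (size (f i) <= (d i).+1)%N) ->
  (size (\prod_(i <- r) f i)%R <= (\sum_(i <- r) d i).+1)%N.
Proof.
move=> fd; elim/big_rec2: _ => [|i a P _ h]; first by rewrite size_poly1.
apply: leq_trans (size_polyMleq _ _) _; have := fd i; lia.
Qed.

Lemma size_line_poly p y e : (size (line_poly p y e) <= (mmeasure (@mdeg n) p).-1.+1)%N.
Proof.
rewrite /line_poly /mmap; apply: leq_trans (size_sum _ _ _) _.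
rewrite big_seq; apply: (big_ind (fun k => (k <= _)%N)) => // [a b ha hb|m mp].
  by rewrite geq_max ha.
apply: (@leq_trans (mdeg m).+1); last exact: leq_trans (mmeasure_mnm_lt _ mp) (leqSpred _).
rewrite mul_polyC; apply: leq_trans (size_scale_leq _ _) _.
rewrite /mmap1 mdegE; apply: size_prod_degrees => j.
apply: leq_trans (size_exp_leq _ _) _; rewrite ltnS.
have : (size ((y ord0 j)%:P + e ord0 j *: 'X : {poly F})%R <= 2)%N.
  apply: leq_trans (size_polyD _ _) _; rewrite geq_max.
  rewrite (leq_trans (size_polyC_leq1 _)) //=.
  by apply: leq_trans (size_scale_leq _ _) _; rewrite size_polyX.
by case: (size _) => [|[|[|k]]] // _; rewrite ?mul0n ?mul1n.
Qed.
End LineRestriction.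

Section EuclideanGeometry.
Local Open Scope complex_scope.
Variables (R : realType) (n : nat).
Implicit Types (x y v : 'rV[R[i]]_n) (phi : {scalar 'rV[R[i]]_n}).

Lemma cexpD (a b : R[i]) : cexp (a + b) = cexp a * cexp b.
Proof.
case: a b => [a1 a2] [b1 b2]; apply/eqP; rewrite eq_complex /= expRD cosD sinD.
by apply/andP; split; apply/eqP; ring.
Qed.

Lemma cmod_le_enorm v j : cmod (v ord0 j) <= enorm v.
Proof.
rewrite -(ger0_norm (cmod_ge0 _)) -sqrtr_sqr ler_wsqrtr // (bigD1 j) //= lerDl.
by rewrite sumr_ge0 // => i _; rewrite exprn_ge0 ?cmod_ge0.
Qed.

Lemma scalar_le_dual_norm phi v : enorm v = 1 -> cmod (phi v) <= dual_norm phi.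
Proof.
move=> v1; apply: ub_le_sup; last by exists v.
exists (\sum_j cmod (phi (delta_mx ord0 j))) => _ [u /= u1 <-].
rewrite [u in phi u]row_sum_delta raddf_sum /=; apply: le_trans (cmod_sum_le _) _.
apply: ler_sum => j _; rewrite linearZ /= cmodM ler_piMl ?cmod_ge0 //.
by rewrite -u1 cmod_le_enorm.
Qed.

Lemma spectrum_norm_ge k (lam : 'I_k -> {scalar 'rV[R[i]]_n}) i :
  dual_norm (lam i) <= spectrum_norm lam.
Proof. by rewrite /spectrum_norm; apply: le_bigmax_cond. Qed.

Lemma spectrum_norm_ge0 k (lam : 'I_k -> {scalar 'rV[R[i]]_n}) : 0 <= spectrum_norm lam.
Proof. exact: bigmax_ge_id. Qed.

Lemma cmodB_sqr_le (a b : R[i]) : cmod (a - b) ^+ 2 <= 2 * cmod a ^+ 2 + 2 * cmod b ^+ 2.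
Proof.
have ab : cmod (a - b) <= cmod a + cmod b.
  apply: le_trans (cmodD _ _) _.
  by rewrite lerD // -lecR -normrC_cmod normrN normrC_cmod.
apply: (@le_trans _ _ ((cmod a + cmod b) ^+ 2)).
  by rewrite lerXn2r ?nnegrE ?addr_ge0 ?cmod_ge0.
move: (cmod a) (cmod b) => r1 r2.
have := sqr_ge0 (r1 - r2); nra.
Qed.

Lemma sqr_enorm v : enorm v ^+ 2 = \sum_j cmod (v ord0 j) ^+ 2.
Proof. by rewrite sqr_sqrtr // sumr_ge0 // => j _; rewrite exprn_ge0 ?cmod_ge0. Qed.

Lemma enormB_sqr_le x y : enorm (x - y) ^+ 2 <= 2 * enorm x ^+ 2 + 2 * enorm y ^+ 2.
Proof.
rewrite !sqr_enorm !big_distrr -big_split /=; apply: ler_sum => j _.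
by rewrite !mxE; exact: cmodB_sqr_le.
Qed.

Lemma enormZ_sqr (a : R) v : enorm (a%:C *: v) ^+ 2 = a ^+ 2 * enorm v ^+ 2.
Proof.
rewrite !sqr_enorm big_distrr; apply: eq_bigr => j _.
by rewrite mxE cmodM cmodR exprMn real_normK ?num_real.
Qed.

(** From |x - y|^2 <= 2 |x|^2 + 2 |y|^2 <= 4 for x and y in the unit ball. *)
Lemma line_param_dist_le x v s t : enorm v = 1 ->
  unit_ball (line_param x v s) -> unit_ball (line_param x v t) -> `|s - t| <= 2.
Proof.
have sqr_lt1 z : unit_ball z -> enorm z ^+ 2 <= 1.
  by move=> z1; rewrite expr_le1 ?sqrtr_ge0 // ltW.
move=> v1 /sqr_lt1 hs /sqr_lt1 ht.
have lineB : line_param x v s - line_param x v t = (s - t)%:C *: v.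
  by rewrite /line_param opprD addrACA subrr add0r -scalerBl -rmorphB.
have := enormB_sqr_le (line_param x v s) (line_param x v t).
rewrite lineB enormZ_sqr v1 expr1n mulr1 => st.
rewrite -(ler_pXn2r (n := 2)) ?nnegrE // real_normK ?num_real //.
have p2 : 0 <= 2 :> R by [].
apply: (le_trans st); apply: le_trans (lerD (ler_wpM2l p2 hs) (ler_wpM2l p2 ht)) _.
by rewrite !mulr1 -natrD -natrX.
Qed.

End EuclideanGeometry.

(** * The Remez inequality on a line *)

Section QuasipolynomialRemez.
Local Open Scope complex_scope.

Lemma quasipoly_on_line (R : realType) n k (lam : 'I_k -> {scalar 'rV[R[i]]_n})
    (p : 'I_k -> mpoly n R[i]) (y e : 'rV[R[i]]_n) (u : R) :
  quasipoly lam p (line_param y e u) =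
  exp_poly (fun i => cexp (lam i y) *: line_poly (p i) y e) (fun i => lam i e) u.
Proof.
apply: eq_bigr => i _; rewrite hornerZ line_polyE.
rewrite /line_param raddfD /= linearZ /= cexpD [u%:C * _]mulrC; ring.
Qed.

(** With node gap kappa / (2 (n + 1)) the factor (n + 1)^n / n! is at most
    exp(n + 1) <= 4^(n + 1), so every factor is a power of 2 with exponent linear
    in n, apart from kappa^-n. *)
Lemma remez_constant_le (R : realType) (L kappa : R) n : L *+ 36 <= n%:R -> 0 <= L ->
  0 < kappa <= 1 ->
  expR (L *+ 3) * 2 *
    (2 ^+ n.+1 * (2 ^+ n / ((kappa / (2 * n.+1%:R)) ^+ n * n`!%:R))) <=
  (4 / kappa) ^+ (3 * n + 2).
Proof.
move=> Ln L0 /andP[k0 k1].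
have e1 : expR (L *+ 3) <= 2 ^+ n.
  apply: le_trans (expR_half_le R n); rewrite ler_expR.
  by move: Ln; rewrite -(mulr_natr L 3) -(mulr_natr L 36); lra.
have e2 : n.+1%:R ^+ n / n`!%:R <= 2 ^+ (2 * n.+1) :> R.
  apply: (@le_trans _ _ (exp_sum n.+1 n.+1%:R)).
    by rewrite /exp_sum big_ord_recr /= lerDr sumr_ge0 // => l _; rewrite divr_ge0 ?exprn_ge0.
  apply: le_trans (exp_sum_le_expR _ _) _; first by [].
  apply: le_trans (expR_half_le R (2 * n.+1)).
  by rewrite ler_expR natrM; lra.
have -> : 2 ^+ n / ((kappa / (2 * n.+1%:R)) ^+ n * n`!%:R) =
    2 ^+ n * 2 ^+ n * kappa^-1 ^+ n * (n.+1%:R ^+ n / n`!%:R) :> R.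
  rewrite !(exprMn, exprVn); field.
  by rewrite !expf_neq0 ?gt_eqF // ?ltr0n ?fact_gt0.
have kV : 1 <= kappa^-1 by rewrite invr_ge1 // unitf_gt0.
have k0' : 0 <= kappa^-1 by apply: le_trans kV.
have p2 m : 0 <= 2 ^+ m :> R by rewrite exprn_ge0.
apply: (@le_trans _ _ (2 ^+ n * 2 * (2 ^+ n.+1 * (2 ^+ n * 2 ^+ n * kappa^-1 ^+ n * 2 ^+ (2 * n.+1))))).
  apply: ler_pM; rewrite ?mulr_ge0 ?expR_ge0 ?invr_ge0 ?exprn_ge0 //.
    by rewrite ler_wpM2r.
  by rewrite !ler_wpM2l ?mulr_ge0 ?exprn_ge0.
have -> : 2 ^+ n * 2 * (2 ^+ n.+1 * (2 ^+ n * 2 ^+ n * kappa^-1 ^+ n * 2 ^+ (2 * n.+1))) =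
    4 ^+ (3 * n + 2) * kappa^-1 ^+ n :> R.
  rewrite (_ : 4 = 2 ^+ 2 :> R); last by rewrite -natrX.
  rewrite -exprM (_ : (2 * (3 * n + 2) = n + 1 + (n.+1 + (n + n + 2 * n.+1)))%N); last by lia.
  by rewrite !exprD expr1; ring.
rewrite exprMn ler_wpM2l ?exprn_ge0 // ler_weXn2l //; lia.
Qed.

(** The interval A is rescaled by its length l around a point t0 of O, so that it
    lies in [-1, 1]; this multiplies the frequencies by l, which is at most 4.
    L = 4 M + m dominates them together with the degree, and q + 1 nodes, with q
    of order 36 L, are taken in O. *)
Lemma quasipoly_line_remez (R : realType) n k (lam : 'I_k -> {scalar 'rV[R[i]]_n})
    (p : 'I_k -> mpoly n R[i]) (x v : 'rV[R[i]]_n) (A O : set R) (S : R) (t : R) :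
  (0 < k)%N -> enorm v = 1 -> is_interval A -> has_lbound A ->
  (completed_lebesgue_measure A <= 4%:E)%E -> O `<=` A ->
  (0 < completed_lebesgue_measure O)%E ->
  (forall s, O s -> cmod (quasipoly lam p (line_param x v s)) <= S) -> A t ->
  cmod (quasipoly lam p (line_param x v t)) <=
  (4 * fine (completed_lebesgue_measure A) / fine (completed_lebesgue_measure O))
    `^ (452 * (Num.sqrt k%:R * spectrum_norm lam + (quasipoly_deg p)%:R)) * S.
Proof.
move=> k0 v1 intA lbA nuA4 OA O0 S_ge At.
have [t0 Ot0] : O !=set0.
  apply/set0P/negP => /eqP OE; move: O0; rewrite OE.
  by rewrite [completed_lebesgue_measure _](outer_measure0 ((wlength idfun)^*)%mu) ltxx.
have nuAoo : (completed_lebesgue_measure A < +oo)%E by apply: le_lt_trans nuA4 _; exact: ltry.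
have nuOA := completed_measure_le OA.
set l := fine (completed_lebesgue_measure A).
set w := fine (completed_lebesgue_measure O).
have lE : completed_lebesgue_measure A = l%:E.
  by rewrite fineK // ge0_fin_numE // completed_measure_ge0.
have wE : completed_lebesgue_measure O = w%:E.
  rewrite fineK // ge0_fin_numE ?completed_measure_ge0 //.
  exact: le_lt_trans nuOA nuAoo.
have w0 : 0 < w by rewrite -lte_fin -wE.
have wl : w <= l by rewrite -lee_fin -wE -lE.
have l0 : 0 < l by exact: lt_le_trans wl.
have l4 : l <= 4 by rewrite -lee_fin -lE.
set M := spectrum_norm lam; set m := quasipoly_deg p.
have M0 : 0 <= M by exact: spectrum_norm_ge0.
have m1 : (1 <= m)%N.
  by rewrite /m /quasipoly_deg; case: (k) k0 (p) => // k' _ p'; rewrite big_ord_recl.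
pose L := 4 * M + m%:R.
have L1 : 1 <= L by rewrite -(ler_nat R) in m1; rewrite /L; lra.
have L0 : 0 <= L by lra.
pose q := (Num.truncn (L *+ 36)).+1.
have /andP[q1 q2] : (Num.truncn (L *+ 36))%:R <= L *+ 36 < q%:R.
  by apply: truncn_itv; rewrite mulrn_wge0.
set C := _ `^ _.
have Cge : (4 / (w / l)) ^+ (3 * q + 2) <= C.
  have -> : 4 / (w / l) = 4 * l / w by field; rewrite !gt_eqF.
  rewrite -powR_mulrn; last by rewrite divr_ge0 ?mulr_ge0 ?(ltW l0) ?(ltW w0).
  apply: ler_powR.
    by rewrite ler_pdivlMr // mul1r; lra.
  have sk : 1 <= Num.sqrt (k%:R : R).
    by rewrite -[leLHS]sqrtr1 ler_wsqrtr // ler1n.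
  have skM : M <= Num.sqrt k%:R * M by rewrite -[leLHS]mul1r ler_wpM2r.
  (* 3 q + 2 <= 3 (36 L + 1) + 2 <= 113 L, and 452 = 4 * 113 *)
  rewrite natrD natrM /q -(natr1 (Num.truncn _)).
  move: q1 L1; rewrite -(mulr_natr L 36) /L; move: (Num.truncn _)%:R => r.
  move: skM (ler0n R m); move: (Num.sqrt _ * M) => sM; lra.
have S0 : 0 <= S by apply: le_trans (S_ge _ Ot0); exact: cmod_ge0.
pose d := w / (2 * q.+1%:R).
have d0 : 0 < d by rewrite divr_gt0 // mulr_gt0.
have lbO : has_lbound O by case: lbA => b lb; exists b => s /OA /lb.
have dO : (((2 * d) * q.+1%:R)%R%:E <= completed_lebesgue_measure O)%E.
  rewrite wE lee_fin /d le_eqVlt; apply/orP; left; apply/eqP.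
  by rewrite mulrAC mulrC divfK // mulf_neq0 ?pnatr_eq0.
have [s [sO sgap]] := spaced_nodes d0 lbO dO.
pose y := line_param x v t0; pose e := l%:C *: v.
have lineE r : line_param x v r = line_param y e ((r - t0) / l).
  rewrite /line_param /y /e /line_param -addrA scalerA -scalerDl -rmorphM -rmorphD /=.
  by congr (_ + _%:C *: _); field; rewrite gt_eqF.
pose tau (i : 'I_q.+1) := (s i - t0) / l.
have A1 r : A r -> `|(r - t0) / l| <= 1.
  move=> Ar; rewrite normrM normfV (gtr0_norm l0) ler_pdivrMr // mul1r.
  exact: (interval_dist_le intA nuAoo (OA _ Ot0) Ar).
have tau1 i : `|tau i| <= 1 by apply: A1; apply: OA; apply: sO.
rewrite lineE quasipoly_on_line.
set Q := fun i => _ *: _; set mu := fun i => lam i e.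
have muL i : cmod (mu i) <= L.
  rewrite /mu /e linearZ /= cmodM cmodR (gtr0_norm l0).
  have h : cmod (lam i v) <= M.
    exact: le_trans (scalar_le_dual_norm _ v1) (spectrum_norm_ge _ _).
  apply: (le_trans (ler_pM (ltW l0) (cmod_ge0 _) l4 h)).
  by rewrite /L lerDl ler0n.
have sizeL : (\sum_i size (Q i))%:R <= L.
  apply: (@le_trans _ _ m%:R); last by rewrite /L lerDr mulr_ge0.
  rewrite ler_nat; apply: leq_sum => i _.
  apply: leq_trans (size_scale_leq _ _) _.
  by rewrite add1n; exact: size_line_poly.
have delta0 : 0 < d / l by rewrite divr_gt0.
have gap (i j : 'I_q.+1) : (i < j)%N -> d / l * (j - i)%:R <= tau j - tau i.
  move=> ij; have := sgap i j; rewrite ij ltn_ord => /(_ isT) h.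
  by rewrite /tau -mulrBl mulrAC ler_wpM2r ?invr_ge0 ?(ltW l0) // opprB addrA subrK.
have tauS i : cmod (exp_poly Q mu (tau i)) <= S.
  by rewrite -quasipoly_on_line -lineE; apply: S_ge; exact: sO.
have h := exp_poly_remez muL sizeL (ltW q2) delta0 gap tau1 (A1 _ At) tauS.
apply: (le_trans h).
rewrite [leLHS]mulrCA [leRHS]mulrC ler_wpM2l //; apply: le_trans Cge.
have -> : d / l = w / l / (2 * q.+1%:R) by rewrite /d mulrAC.
apply: (remez_constant_le (ltW q2) L0).
by rewrite divr_gt0 //= ler_pdivrMr // mul1r.
Qed.

End QuasipolynomialRemez.

Theorem proposition1p4 (R : realType) :
  exists2 c : R, 0 < c &
  forall (n k : nat), (0 < n)%N -> (0 < k)%N ->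
  forall (lam : 'I_k -> {scalar 'rV[R[i]]_n})
         (p : 'I_k -> mpoly n R[i])
         (x v : 'rV[R[i]]_n) (I omega : set 'rV[R[i]]_n),
  unit_ball x ->
  enorm v = 1 ->
  line_interval x v I ->
  I `<=` real_line x v `&` @unit_ball R n ->
  line_measurable x v omega ->
  omega `<=` I ->
  (0 < line_measure x v omega)%E ->
  (sup_mod (quasipoly lam p) I <=
     ((4 * fine (line_measure x v I) / fine (line_measure x v omega))
        `^ (c * (Num.sqrt k%:R * spectrum_norm lam + (quasipoly_deg p)%:R)))%:E
     * sup_mod (quasipoly lam p) omega)%E.
Proof.
exists 452; first by rewrite ltr0n.
move=> n k n0 k0 lam p x v I omega _ v1 [IL intI] Iball _ oI.
rewrite /line_measure; set A := _ @^-1` I in intI *; set O := _ @^-1` omega => O0.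
have OA : O `<=` A by move=> t; exact: oI.
have [t0 Ot0] : O !=set0.
  apply/set0P/negP => /eqP OE; move: O0; rewrite OE.
  by rewrite [completed_lebesgue_measure _](outer_measure0 ((wlength idfun)^*)%mu) ltxx.
have A2 t : A t -> t0 - 2 <= t <= t0 + 2.
  move=> At; rewrite -ler_distl.
  by apply: (line_param_dist_le v1); [exact: (Iball _ At).2 | exact: (Iball _ (OA _ Ot0)).2].
have lbA : has_lbound A by exists (t0 - 2) => t /A2/andP[].
have nuA4 : (completed_lebesgue_measure A <= 4%:E)%E.
  have -> : 4 = (t0 + 2) - (t0 - 2) :> R by ring.
  rewrite -completed_measure_itvcc; last by lra.
  by apply: completed_measure_le => t /A2 h; rewrite /= in_itv.
have remez := quasipoly_line_remez k0 v1 intI lbA nuA4 OA O0.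
apply: ge_ereal_sup => _ [z Iz <-].
have [t _ zE] := IL _ Iz.
have At : A t by rewrite /A /= zE.
have sup_ge y : omega y -> ((cmod (quasipoly lam p y))%:E <= sup_mod (quasipoly lam p) omega)%E.
  by move=> oy; apply: ereal_sup_ubound; exists y.
case SE: (sup_mod _ omega) sup_ge => [S| |] sup_ge.
- rewrite -EFinM lee_fin -zE; apply: remez At => s Os.
  by rewrite -lee_fin; exact: sup_ge.
- rewrite gt0_muley ?leey // lte_fin powR_gt0 // divr_gt0 ?mulr_gt0 //.
    apply: fine_gt0; rewrite (lt_le_trans O0 (completed_measure_le OA)) /=.
    by apply: le_lt_trans nuA4 _; exact: ltry.
  apply: fine_gt0; rewrite O0 /=.
  by apply: le_lt_trans (le_trans (completed_measure_le OA) nuA4) _; exact: ltry.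
- by have := sup_ge _ Ot0; rewrite leeNy_eq.
Qed.
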